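(* Let $G$ be a finite group or a compact Lie group and $\gamma$ a multiplier of $G$. Let $D^r_\gamma$ and $D^l_{\gamma^{-1}}$ be irreducible projective unitary (matrix) representations of $G$ with multipliers $\gamma$ and $\gamma^{-1}$, and let $X$ and $Y$ be irreducible projective unitary (matrix) representations of $G$, both with multiplier $\gamma$. Assume that $X$ and $D^r_\gamma$ are either equal or inequivalent, and that $\overline{Y}$ and $D^l_{\gamma^{-1}}$ are either equal or inequivalent. Let $B=\{B^{m,n}\}$, $m=1,\dots,\dim(l)$, $n=1,\dots,\dim(r)$, be a tensor of $\dim(Y)\times\dim(X)$ matrices that is an elementary block, i.e. for all $g\in G$ and all $m,n$ $$\sum_{n'}D^r_\gamma(g)_{n,n'}B^{m,n'}=B^{m,n}X(g),\qquad\sum_{m'}D^l_{\gamma^{-1}}(g)_{m,m'}B^{m',n}=Y(g)^{-1}B^{m,n}.$$ If $X(g)=D^r_\gamma(g)$ and $\overline{Y(g)}=D^l_{\gamma^{-1}}(g)$ for all $g$, then $B$ is proportional to the tensor composed of the matrices $$B^{m,n}=|m\rangle\langle n|,\qquad m=1,\dots,\dim(l),\ n=1,\dots,\dim(r).$$ Otherwise $B=0$.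
   Context: A multiplier of $G$ is a function $\gamma:G\times G\to U(1)$ with $\gamma(g,h)\gamma(gh,f)=\gamma(g,hf)\gamma(h,f)$ and $\gamma(g,e)=\gamma(e,g)=1$ (continuous if $G$ is a compact Lie group). A projective unitary representation with multiplier $\gamma$ is a map $\Theta$ from $G$ to unitaries with $\Theta(g)\Theta(h)=\gamma(g,h)\Theta(gh)$. Two projective representations $\Theta,\Theta'$ with the same multiplier are equivalent if there is a linear isomorphism $\phi$ with $\Theta'(g)\phi=\phi\Theta(g)$ for all $g$. $\overline{Y}$ denotes the entrywise complex conjugate representation (it has multiplier $\gamma^{-1}$). The tensor $B$ is indexed by the basis $|m\rangle\otimes|n\rangle$ of the physical space $\mathcal{H}_l\otimes\mathcal{H}_r$, on which $\mathcal{R}(g)=\mathbb{I}\otimes D^r_\gamma(g)$ and $\mathcal{L}(g)=D^l_{\gamma^{-1}}(g)\otimes\mathbb{I}$ act; ''proportional'' means equal up to one common scalar factor (which may be zero). $|m\rangle\langle n|$ is the matrix unit with a single entry $1$ in position $(m,n)$. *)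

(* Defs.v *)
From HB Require Import structures.
From mathcomp Require Import all_boot all_order all_fingroup all_algebra.
From mathcomp Require Import complex.
From mathcomp Require Import all_classical all_reals all_analysis.

Set Implicit Arguments.
Unset Strict Implicit.
Unset Printing Implicit Defensive.

Import Order.TTheory GRing.Theory Num.Theory.
Import numFieldNormedType.Exports.

Local Open Scope classical_set_scope.
Local Open Scope ring_scope.
Local Open Scope complex_scope.

(* Only meaningful for open [D].  All iterated directional derivatives up to
   order [k] exist and are continuous at the points of [D]; for
   finite-dimensional [V] this is the usual C^k condition. *)
Fixpoint Ck_on (R : realType) (V W : normedModType R) (k : nat)
    (D : set V) (f : V -> W) : Prop :=
  (forall x, D x -> {for x, continuous f}) /\
  match k with
  | 0%N => True
  | k'.+1 => forall v, (forall x, D x -> derivable f x v) /\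
                       Ck_on k' D (fun x => 'D_v f x)
  end.

Definition smooth_on (R : realType) (V W : normedModType R)
    (D : set V) (f : V -> W) : Prop :=
  forall k, Ck_on k D f.

(* [chart_map] is relevant only on [chart_dom], [chart_inv] only on its image *)
Record chart (R : realType) (M : topologicalType) (d : nat) := Chart {
  chart_dom : set M;
  chart_map : M -> 'rV[R]_d;
  chart_inv : 'rV[R]_d -> M
}.

Definition chart_img (R : realType) (M : topologicalType) (d : nat)
    (c : chart R M d) : set 'rV[R]_d :=
  chart_map c @` chart_dom c.

Definition is_chart (R : realType) (M : topologicalType) (d : nat)
    (c : chart R M d) : Prop :=
  [/\ open (chart_dom c),
      open (chart_img c),
      forall x, chart_dom c x -> chart_inv c (chart_map c x) = x,
      forall x, chart_dom c x -> {for x, continuous (chart_map c)}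
    & forall u, chart_img c u -> {for u, continuous (chart_inv c)}].

Definition smooth_atlas (R : realType) (M : topologicalType) (d : nat)
    (A : set (chart R M d)) : Prop :=
  [/\ forall c, A c -> is_chart c,
      forall x, exists2 c, A c & chart_dom c x
    & forall c c', A c -> A c' ->
        smooth_on [set u | chart_img c u /\ chart_dom c' (chart_inv c u)]
                  (chart_map c' \o chart_inv c)].

HB.mixin Record isLieGroup (R : realType) G
    of monoid.Group G & Topological G := {
  lie_dim : nat;
  lie_atlas : set (chart R G lie_dim);
  lie_hausdorff : hausdorff_space G;
  lie_second_countable : @second_countable G;
  lie_smooth_atlas : smooth_atlas lie_atlas;
  (* makes the domains below open, so that smoothness on them is meaningful *)
  lie_mul_continuous : continuous (fun gh : G * G => gh.1 * gh.2)%g;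
  lie_inv_continuous : continuous (fun g : G => g^-1)%g;
  lie_smooth_mul : forall a b c,
    lie_atlas a -> lie_atlas b -> lie_atlas c ->
    smooth_on
      [set uv : 'rV[R]_lie_dim * 'rV[R]_lie_dim |
        [/\ chart_img a uv.1, chart_img b uv.2 &
            chart_dom c (chart_inv a uv.1 * chart_inv b uv.2)%g]]
      (fun uv => chart_map c (chart_inv a uv.1 * chart_inv b uv.2)%g);
  lie_smooth_inv : forall a b, lie_atlas a -> lie_atlas b ->
    smooth_on
      [set u | chart_img a u /\ chart_dom b (chart_inv a u)^-1%g]
      (fun u => chart_map b (chart_inv a u)^-1%g)
}.

#[short(type="lieGroupType")]
HB.structure Definition LieGroup (R : realType) :=
  {G of isLieGroup R G & monoid.Group G & Topological G}.

Inductive finite_or_compact_lie (R : realType) : Type :=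
| FiniteGroup (G : finGroupType)
| CompactLieGroup (G : lieGroupType R) of compact [set: G].

Definition group_of (R : realType) (G : finite_or_compact_lie R) : groupType :=
  match G with
  | FiniteGroup H => H
  | CompactLieGroup H _ => H
  end.

Coercion group_of : finite_or_compact_lie >-> Group.type.

(* [R[i]^o] carries the topology of the modulus *)
Definition continuous_if_lie (R : realType) (G : finite_or_compact_lie R) :
    (G -> G -> R[i]) -> Prop :=
  match G with
  | FiniteGroup _ => fun _ => True
  | CompactLieGroup H _ => fun gamma : H -> H -> R[i] =>
      continuous (fun p : H * H => gamma p.1 p.2 : R[i]^o)
  end.

Definition multiplier (R : realType) (G : finite_or_compact_lie R)
    (gamma : G -> G -> R[i]) : Prop :=
  [/\ forall g h, `|gamma g h| = 1,
      forall g h f,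
        gamma g h * gamma (g * h)%g f = gamma g (h * f)%g * gamma h f,
      forall g, gamma g 1%g = 1 /\ gamma 1%g g = 1
    & continuous_if_lie gamma].

Definition multiplier_inv (R : realType) (G : groupType)
    (gamma : G -> G -> R[i]) : G -> G -> R[i] :=
  fun g h => (gamma g h)^-1.

Definition projective_unitary (R : realType) (G : groupType)
    (gamma : G -> G -> R[i]) (d : nat) (Theta : G -> 'M[R[i]]_d) : Prop :=
  (forall g, Theta g \is unitarymx) /\
  (forall g h, Theta g *m Theta h = gamma g h *: Theta (g * h)%g).

Definition irreducible_rep (R : realType) (G : groupType) (d : nat)
    (Theta : G -> 'M[R[i]]_d) : Prop :=
  (0 < d)%N /\
  forall U : {vspace 'cV[R[i]]_d},
    (forall g v, v \in U -> Theta g *m v \in U) ->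
    U = 0%VS \/ U = fullv.

(* equality as matrix-valued functions, for dimensions that are not
   definitionally the same *)
Definition equal_rep (R : realType) (G : groupType) (d d' : nat)
    (Theta : G -> 'M[R[i]]_d) (Theta' : G -> 'M[R[i]]_d') : Prop :=
  exists e : d = d', forall g, castmx (e, e) (Theta g) = Theta' g.

Definition equivalent_rep (R : realType) (G : groupType) (d d' : nat)
    (Theta : G -> 'M[R[i]]_d) (Theta' : G -> 'M[R[i]]_d') : Prop :=
  exists2 phi : {linear 'cV[R[i]]_d -> 'cV[R[i]]_d'},
    bijective phi &
    forall g v, Theta' g *m phi v = phi (Theta g *m v).

Definition conj_rep (R : realType) (G : groupType) (d : nat)
    (Theta : G -> 'M[R[i]]_d) : G -> 'M[R[i]]_d :=
  fun g => map_mx Num.conj (Theta g).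

Definition elementary_block (R : realType) (G : groupType) (l r y x : nat)
    (Dl : G -> 'M[R[i]]_l) (Dr : G -> 'M[R[i]]_r)
    (Y : G -> 'M[R[i]]_y) (X : G -> 'M[R[i]]_x)
    (B : 'I_l -> 'I_r -> 'M[R[i]]_(y, x)) : Prop :=
  forall g m n,
    \sum_(n' < r) Dr g n n' *: B m n' = B m n *m X g /\
    \sum_(m' < l) Dl g m m' *: B m' n = invmx (Y g) *m B m n.

(* Main.v *)
(* For fixed m and p, the matrix (B^{m,n}_{p,q})_{n,q} intertwines D^r and X;
   for fixed n and q, unitarity of Y makes (B^{m,n}_{p,q})_{m,p} intertwine D^l
   and the conjugate of Y.  Schur's lemma makes both kinds of slices vanish or,
   when the representations coincide, scalar:
   B^{m,n}_{p,q} = c(m,p) [n = q] = d(n,q) [m = p],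
   so c(m,p) = c [m = p] for one constant c. *)
Require Import Defs.
From HB Require Import structures.
From mathcomp Require Import all_boot all_order all_fingroup all_algebra.
From mathcomp Require Import complex.
From mathcomp Require Import all_classical all_reals all_analysis.

Set Implicit Arguments.
Unset Strict Implicit.
Unset Printing Implicit Defensive.

Import Order.TTheory GRing.Theory Num.Theory.

Local Open Scope ring_scope.
Local Open Scope complex_scope.

(* Irreducibility in terms of a matrix whose columns span an invariant
   subspace: this form is visibly stable under entrywise conjugation. *)
Definition irreducible_mx (K : fieldType) (T : Type) (d : nat)
    (Theta : T -> 'M[K]_d) : Prop :=
  forall k (A : 'M[K]_(d, k)),
    (forall g, exists C : 'M[K]_k, Theta g *m A = A *m C) ->
    A = 0 \/ exists P : 'M[K]_(k, d), A *m P = 1%:M.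

(** The relation [Theta g *m A = A *m C] makes the column space of [A] invariant, so irreducibility
    applies to it. If it is the full space, solving for each basis vector gives the columns of a
    right inverse. *)
Lemma irreducible_rep_mx (R : realType) (G : groupType) (d : nat)
    (Theta : G -> 'M[R[i]]_d) :
  irreducible_rep Theta -> irreducible_mx Theta.
Proof.
case=> _ irr k A invA.
pose f : 'Hom('cV[R[i]]_k, 'cV[R[i]]_d) := linfun (mulmx A).
have fE v : f v = A *m v by rewrite lfunE.
have [|/vspaceP f0|/vspaceP f1] := irr (limg f).
- move=> g _ /memv_imgP[u _ ->]; have [C eC] := invA g.
  by rewrite fE mulmxA eC -mulmxA -fE memv_img ?memvf.
- left; apply/matrixP => i j.
  have : f (delta_mx j 0) \in limg f by rewrite memv_img ?memvf.
  by rewrite f0 memv0 fE -colE => /eqP/matrixP/(_ i 0); rewrite !mxE.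
- right.
  have pre j : exists u : 'cV[R[i]]_k, A *m u = delta_mx j 0.
    have : (delta_mx j 0 : 'cV[R[i]]_d) \in limg f by rewrite f1 memvf.
    by case/memv_imgP => u _ ->; exists u; rewrite fE.
  have [u uP] := choice pre.
  exists (\matrix_(a, j) u j a 0).
  apply/matrixP => a j; rewrite -[RHS]mulr1n.
  have /matrixP/(_ a 0) := uP j; rewrite !mxE eqxx andbT => <-.
  by apply: eq_bigr => b _; rewrite mxE.
Qed.

(** Applying [s] to the invariance relation moves it from [A] to [map_mx s A]. With [s] the complex
    conjugation, this transfers irreducibility from [Y] to [conj_rep Y]. *)
Lemma irreducible_mx_map (K : fieldType) (T : Type) (d : nat)
    (s : {rmorphism K -> K}) (Theta : T -> 'M[K]_d) :
  involutive s -> irreducible_mx Theta ->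
  irreducible_mx (fun g => map_mx s (Theta g)).
Proof.
move=> sK irr k A invA.
have mxK m n (M : 'M[K]_(m, n)) : map_mx s (map_mx s M) = M.
  by apply/matrixP => a b; rewrite !mxE sK.
have [|A0|[P AP]] := irr k (map_mx s A).
- move=> g; have [C eC] := invA g; exists (map_mx s C).
  by rewrite -map_mxM -eC map_mxM mxK.
- by left; rewrite -[A]mxK A0 map_mx0.
- by right; exists (map_mx s P); rewrite -[A]mxK -map_mxM AP map_mx1.
Qed.

(** The image of [M] is invariant under [S1] and its kernel under [S2], so irreducibility leaves
    only the zero and the invertible case. *)
Lemma schur_mx (K : fieldType) (T : Type) (a b : nat)
    (S1 : T -> 'M[K]_a) (S2 : T -> 'M[K]_b) (M : 'M[K]_(a, b)) :
  irreducible_mx S1 -> irreducible_mx S2 ->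
  (forall g, S1 g *m M = M *m S2 g) ->
  M = 0 \/ exists2 P : 'M[K]_(b, a), M *m P = 1%:M & P *m M = 1%:M.
Proof.
move=> irr1 irr2 comm.
have [|->|[P MP]] := irr1 b M; [by move=> g; exists (S2 g) | by left |].
(* [kermx] is a left kernel, so after transposition the columns of [N^T] span the kernel of [M] on
   column vectors. *)
pose N := kermx M^T.
have MN : M *m N^T = 0 by apply: trmx_inj; rewrite trmx_mul trmxK mulmx_ker trmx0.
have [g|/(congr1 trmx)/eqP|[C NC]] := irr2 b N^T.
- have /sub_kermxP/submxP[D eD] : (S2 g *m N^T)^T *m M^T = 0.
    by rewrite -trmx_mul mulmxA -comm -mulmxA MN mulmx0 trmx0.
  by exists D^T; rewrite -trmx_mul -eD trmxK.
- rewrite trmxK trmx0 kermx_eq0 => /row_freeP[L /(congr1 trmx)].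
  rewrite trmx_mul trmxK trmx1 => LM; right; exists P => //.
  suff -> : P = L^T by [].
  by rewrite -[P]mul1mx -LM -mulmxA MP mulmx1.
- by left; rewrite -[M]mulmx1 -NC mulmxA MN mul0mx.
Qed.

(** A nonzero intertwiner is invertible, and its inverse, which maps the space of [S1] to that of
    [S2], would be an equivalence. *)
Lemma schur_equivalent (R : realType) (G : groupType) (a b : nat)
    (S1 : G -> 'M[R[i]]_a) (S2 : G -> 'M[R[i]]_b) (M : 'M[R[i]]_(a, b)) :
  irreducible_mx S1 -> irreducible_mx S2 ->
  (forall g, S1 g *m M = M *m S2 g) ->
  ~ equivalent_rep S1 S2 -> M = 0.
Proof.
move=> irr1 irr2 comm neq.
have [//|[P MP PM]] := @schur_mx _ _ _ _ _ _ M irr1 irr2 comm.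
case: neq; exists (mulmx P : {linear 'cV[R[i]]_a -> 'cV[R[i]]_b}).
  by exists (mulmx M) => v; rewrite /= mulmxA ?MP ?PM mul1mx.
move=> g v; rewrite /= !mulmxA; congr (_ *m _).
by rewrite -[S2 g]mul1mx -PM -(mulmxA P) -comm -!mulmxA MP mulmx1.
Qed.

(** For an eigenvalue [c] of [M], the matrix [M - c%:M] still commutes with [S] but kills a nonzero
    row vector. It is thus not invertible, hence zero. *)
Lemma schur_scalar (C : numClosedFieldType) (T : Type) (d : nat)
    (S : T -> 'M[C]_d) (M : 'M[C]_d) :
  (0 < d)%N -> irreducible_mx S -> (forall g, S g *m M = M *m S g) ->
  exists c, M = c%:M.
Proof.
move=> d_gt0 irr comm; have [c /eigenvalueP[v vM v0]] := eigenvalue_closed M d_gt0.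
exists c; apply/eqP; rewrite -subr_eq0; apply/eqP.
have [g|//|[P MP _]] := @schur_mx _ _ _ _ _ _ (M - c%:M) irr irr.
  by rewrite mulmxBl mulmxBr comm scalar_mxC.
case/eqP: v0.
by rewrite -[v]mulmx1 -MP mulmxA mulmxBr vM mul_mx_scalar subrr mul0mx.
Qed.

Definition right_slice (K : Type) (l r y x : nat)
    (B : 'I_l -> 'I_r -> 'M[K]_(y, x)) (m : 'I_l) (p : 'I_y) : 'M[K]_(r, x) :=
  \matrix_(n, q) B m n p q.

Definition left_slice (K : Type) (l r y x : nat)
    (B : 'I_l -> 'I_r -> 'M[K]_(y, x)) (n : 'I_r) (q : 'I_x) : 'M[K]_(l, y) :=
  \matrix_(m, p) B m n p q.

Section Slices.
Context (R : realType) (G : groupType) (l r y x : nat).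
Context (Dl : G -> 'M[R[i]]_l) (Dr : G -> 'M[R[i]]_r).
Context (Y : G -> 'M[R[i]]_y) (X : G -> 'M[R[i]]_x).
Context (B : 'I_l -> 'I_r -> 'M[R[i]]_(y, x)).
Hypothesis hB : elementary_block Dl Dr Y X B.

Lemma right_slice_intertwines m p g :
  Dr g *m right_slice B m p = right_slice B m p *m X g.
Proof.
apply/matrixP => n q; have [/matrixP/(_ p q) e _] := hB g m n.
move: e; rewrite summxE !mxE => e.
under eq_bigr do rewrite mxE.
under [RHS]eq_bigr do rewrite mxE.
by rewrite -e; apply: eq_bigr => j _; rewrite mxE.
Qed.

(** By unitarity the entry (p, p') of the inverse of [Y g] is the conjugate of its entry (p', p).
    Left multiplication by the inverse therefore becomes right multiplication of the slice by
    [conj_rep Y g]. *)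
Lemma left_slice_intertwines n q g : Y g \is unitarymx ->
  Dl g *m left_slice B n q = left_slice B n q *m conj_rep Y g.
Proof.
move=> uY; apply/matrixP => m p; have [_ /matrixP/(_ p q) e] := hB g m n.
move: e; rewrite invmx_unitary // summxE !mxE => e.
under eq_bigr do rewrite mxE.
under [RHS]eq_bigr do rewrite !mxE mulrC.
transitivity (\sum_(i < l) (Dl g m i *: B i n) p q).
  by apply: eq_bigr => j _; rewrite mxE.
by rewrite e; apply: eq_bigr => j _; rewrite !mxE.
Qed.

End Slices.

Theorem proposition3 (R : realType) (G : finite_or_compact_lie R)
    (gamma : G -> G -> R[i]) (hgamma : multiplier gamma)
    (l r y x : nat)
    (Dr : G -> 'M[R[i]]_r) (Dl : G -> 'M[R[i]]_l)
    (X : G -> 'M[R[i]]_x) (Y : G -> 'M[R[i]]_y)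
    (hDr : projective_unitary gamma Dr) (iDr : irreducible_rep Dr)
    (hDl : projective_unitary (multiplier_inv gamma) Dl)
    (iDl : irreducible_rep Dl)
    (hX : projective_unitary gamma X) (iX : irreducible_rep X)
    (hY : projective_unitary gamma Y) (iY : irreducible_rep Y)
    (hXDr : equal_rep Dr X \/ ~ equivalent_rep Dr X)
    (hYDl : equal_rep Dl (conj_rep Y) \/ ~ equivalent_rep Dl (conj_rep Y))
    (B : 'I_l -> 'I_r -> 'M[R[i]]_(y, x))
    (hB : elementary_block Dl Dr Y X B) :
  (forall (er : r = x) (el : l = y),
     (forall g, X g = castmx (er, er) (Dr g)) ->
     (forall g, conj_rep Y g = castmx (el, el) (Dl g)) ->
     exists c : R[i], forall m n,
       B m n = c *: delta_mx (cast_ord el m) (cast_ord er n)) /\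
  (~ (equal_rep Dr X /\ equal_rep Dl (conj_rep Y)) ->
     forall m n, B m n = 0).
Proof.
have mDr := irreducible_rep_mx iDr; have mX := irreducible_rep_mx iX.
have mDl := irreducible_rep_mx iDl.
have mY : irreducible_mx (conj_rep Y).
  by apply: irreducible_mx_map; [exact: conjCK | exact: irreducible_rep_mx].
have hr := right_slice_intertwines hB.
have hl n q g := left_slice_intertwines hB n q (hY.1 g).
split=> [er el|neq m n].
(* Eliminating the dimension equalities turns the casts into identities. *)
- case: x / er X B hX iX hXDr hB mX hr hl => {}X {}B _ _ _ _ _ hr hl eX.
  case: y / el Y B hY iY hYDl mY hr hl => {}Y {}B _ _ _ _ hr hl eY.
  (* A reference index, available because the dimension is positive. The left slice at [n0], [n0]
     fixes the common factor [d], and each right slice, being scalar, is determined by its entry at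
     [n0], [n0]. *)
  pose n0 : 'I_r := Ordinal iDr.1.
  have [d dP] : exists d, left_slice B n0 n0 = d%:M.
    by apply: (schur_scalar iDl.1 mDl) => g; rewrite hl eY castmx_id.
  exists d => m n; apply/matrixP => p q; rewrite !cast_ord_id.
  have [|c /matrixP cP] := schur_scalar (M := right_slice B m p) iDr.1 mDr.
    by move=> g; rewrite hr eX castmx_id.
  have := cP n q; rewrite !mxE => ->.
  have := cP n0 n0; rewrite !mxE eqxx mulr1n => <-.
  have /matrixP/(_ m p) := dP; rewrite !mxE => ->.
  by rewrite [p == m]eq_sym [q == n]eq_sym -mulrnA mulnb mulr_natr.
- have [eqr|nr] := hXDr; last first.
    apply/matrixP => p q; have := schur_equivalent mDr mX (hr m p) nr.
    by move/matrixP/(_ n q); rewrite !mxE.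
  have [eql|nl] := hYDl; first by case: neq.
  apply/matrixP => p q; have := schur_equivalent mDl mY (hl n q) nl.
  by move/matrixP/(_ m p); rewrite !mxE.
Qed.
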